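(* Let $0<\beta\le n$ and let $f\in L^1_{\mathrm{loc}}(H^\beta_\infty)$ be such that $M_\beta f(x)<+\infty$ for $H^\beta_\infty$-quasi-every $x\in\mathbb{R}^n$. Then, for every $\delta\in[0,1)$, the function $(M_\beta f)^\delta$ is an $A_{1,\beta}$ weight.
   Context: Cubes in $\mathbb{R}^n$ have sides parallel to the coordinate axes; $\ell(Q)$ is the side length of $Q$. For $0<\beta\le n$, the $\beta$-dimensional Hausdorff content of $E\subseteq\mathbb{R}^n$ is $H^\beta_\infty(E)=\inf\{\sum_{j}\omega_\beta r_j^\beta: E\subseteq\bigcup_{j=1}^\infty B_j\}$, with $B_j$ open balls of radius $r_j$ and $\omega_\beta=\pi^{\beta/2}/\Gamma(\beta/2+1)$; equivalently, up to multiplicative constants (which are immaterial here), $\inf\{\sum_j \ell(Q_j)^\beta: E\subseteq\bigcup_{j=1}^\infty Q_j\}$ with $Q_j$ cubes. For $f:\mathbb{R}^n\to[0,\infty]$ the Choquet integral is $\int_{\mathbb{R}^n} f\,\mathrm{d}H^\beta_\infty=\int_0^\infty H^\beta_\infty(\{x: f(x)>t\})\,\mathrm{d}t$, and $\int_E f\,\mathrm{d}H^\beta_\infty=\int_{\mathbb{R}^n} f\chi_E\,\mathrm{d}H^\beta_\infty$ for $E\subseteq\mathbb{R}^n$. A property holds for $H^\beta_\infty$-quasi-every $x$ if it holds outside a set $E$ with $H^\beta_\infty(E)=0$. A function $f$ is quasi-continuous if for every $\varepsilon>0$ there is an open set $U$ with $H^\beta_\infty(U)<\varepsilon$ such that $f|_{\mathbb{R}^n\setminus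 U}$ is finite and continuous. $L^1_{\mathrm{loc}}(H^\beta_\infty)$ is the set of quasi-continuous $f:\mathbb{R}^n\to[-\infty,\infty]$ with $\int_K|f|\,\mathrm{d}H^\beta_\infty<\infty$ for every compact $K\subseteq\mathbb{R}^n$. The maximal operator is $M_\beta f(x)=\sup_{Q\ni x}\frac{1}{H^\beta_\infty(Q)}\int_Q|f|\,\mathrm{d}H^\beta_\infty$, the supremum being over all cubes $Q$ containing $x$ (the formula makes sense for any function). A weight is a non-negative function on $\mathbb{R}^n$ (values in $[0,\infty]$). A weight $w$ is an $A_{1,\beta}$ weight if there is a constant $K>0$ such that $M_\beta w(x)\le K w(x)$ for $H^\beta_\infty$-quasi-every $x\in\mathbb{R}^n$. For $\delta=0$, $(M_\beta f)^0$ is the constant function $1$. *)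

(* Defs.v *)
From HB Require Import structures.
From mathcomp Require Import all_boot all_order all_algebra.
From mathcomp Require Import all_classical all_reals all_analysis.
Set Implicit Arguments.
Unset Strict Implicit.
Unset Printing Implicit Defensive.
Import Order.TTheory GRing.Theory Num.Theory.
Import numFieldNormedType.Exports.

Local Open Scope classical_set_scope.
Local Open Scope ring_scope.
Local Open Scope ereal_scope.

(* R^n is 'rV[R]_n, whose library topology is the Euclidean one. The library
   ball on 'rV[R]_n is that of the sup norm, hence the definition below. *)
Definition eucl_ball (R : realType) (n : nat) (x : 'rV[R]_n) (r : R) :
    set 'rV[R]_n :=
  [set y | (Num.sqrt (\sum_(i < n) (x ord0 i - y ord0 i) ^+ 2) < r)%R].

(* Euler's integral; only used for s > 0. *)
Definition Gamma (R : realType) (s : R) : R :=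
  (\int[lebesgue_measure]_(t in `]0%R, +oo[) (t `^ (s - 1) * expR (- t)))%R.

Definition omega (R : realType) (beta : R) : R :=
  (pi `^ (beta / 2) / Gamma (beta / 2 + 1))%R.

Definition hcontent (R : realType) (n : nat) (beta : R) (E : set 'rV[R]_n) :
    \bar R :=
  ereal_inf [set s | exists (c : nat -> 'rV[R]_n) (r : nat -> R),
    [/\ forall j, (0 < r j)%R,
        E `<=` \bigcup_j eucl_ball (c j) (r j)
      & s = \sum_(0 <= j <oo) (omega beta * r j `^ beta)%:E]].

(* The integrand is nonincreasing in t, so the Lebesgue integral is the
   classical one. *)
Definition choquet (R : realType) (n : nat) (beta : R)
    (f : 'rV[R]_n -> \bar R) : \bar R :=
  \int[lebesgue_measure]_(t in `]0%R, +oo[) hcontent beta [set x | t%:E < f x].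

Definition choquet_on (R : realType) (n : nat) (beta : R) (E : set 'rV[R]_n)
    (f : 'rV[R]_n -> \bar R) : \bar R :=
  choquet beta (f \_ E).

Definition quasi_every (R : realType) (n : nat) (beta : R)
    (P : 'rV[R]_n -> Prop) : Prop :=
  exists E : set 'rV[R]_n,
    hcontent beta E = 0 /\ forall x, ~ E x -> P x.

Definition quasi_continuous (R : realType) (n : nat) (beta : R)
    (f : 'rV[R]_n -> \bar R) : Prop :=
  forall e : R, (0 < e)%R -> exists U : set 'rV[R]_n,
    [/\ open U, hcontent beta U < e%:E,
        forall x, ~ U x -> f x \is a fin_num
      & {within ~` U, continuous f}].

Definition L1loc (R : realType) (n : nat) (beta : R)
    (f : 'rV[R]_n -> \bar R) : Prop :=
  quasi_continuous beta f /\
  forall K : set 'rV[R]_n, compact K ->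
    choquet_on beta K (fun x => `|f x|) < +oo.

(* A product of n nondegenerate bounded intervals of the same length l. Each
   endpoint of each side may or may not belong to it: for b : bool, BSide b z
   as a left (resp. right) bound includes z iff b is true (resp. false). *)
Definition is_cube (R : realType) (n : nat) (Q : set 'rV[R]_n) : Prop :=
  exists (a : 'rV[R]_n) (l : R) (b c : 'I_n -> bool), (0 < l)%R /\
    Q = [set x | forall i : 'I_n,
           x ord0 i \in Interval (BSide (b i) (a ord0 i))
                                 (BSide (c i) (a ord0 i + l)%R)].

Definition maximal (R : realType) (n : nat) (beta : R)
    (f : 'rV[R]_n -> \bar R) (x : 'rV[R]_n) : \bar R :=
  ereal_sup [set (hcontent beta Q)^-1 * choquet_on beta Q (fun y => `|f y|)
            | Q in [set Q : set 'rV[R]_n | is_cube Q /\ Q x]].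

Definition is_weight (R : realType) (n : nat) (w : 'rV[R]_n -> \bar R) : Prop :=
  forall x, 0 <= w x.

Definition A1_weight (R : realType) (n : nat) (beta : R)
    (w : 'rV[R]_n -> \bar R) : Prop :=
  is_weight w /\
  exists K : R, (0 < K)%R /\
    quasi_every beta (fun x => maximal beta w x <= K%:E * w x).

(* Main.v *)
(* Fix a cube Q containing x, and let m = M f(x) be finite. A cube meeting Q on
   which the average of |f| exceeds s >= 8^n m must be shorter than Q, so the set
   where M f > s inside Q only depends on f in a dilate Q' of Q, and a weak-type
   (1,1) estimate bounds its content by (C / s) times the integral of |f| over
   Q', hence by C' (m / s) H(Q). Integrating in s as in Kolmogorov's inequality
   gives that the integral of (M f)^delta over Q is at most K m^delta H(Q).

   Since the content is not additive, the weak-type estimate does not follow from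
   disjointness of a covering family of dyadic cells. One extracts instead a
   maximal disjoint subfamily S whose members inside any dyadic cell D have total
   content at most 2 H(D). For such S the sum of H(c & E) over c in S is at most
   C H(E), so integrals over the cells of S add up to at most C times the whole
   integral, while maximality lets S control the content of the whole family.

   Only monotonicity, countable subadditivity, translation invariance and an upper
   bound on the content of balls are used, never a lower bound: the content of a
   dyadic cell itself plays the role of the power of its side. *)

Require Import Defs.
From mathcomp Require Import all_boot all_order all_algebra.
From mathcomp Require Import all_classical all_reals all_analysis.
From mathcomp Require Import measurable_realfun.
From mathcomp Require Import ring lra zify.
Set Implicit Arguments.
Unset Strict Implicit.
Unset Printing Implicit Defensive.
Import Order.TTheory GRing.Theory Num.Theory.
Import numFieldNormedType.Exports.

Local Open Scope classical_set_scope.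
Local Open Scope ring_scope.
Local Open Scope ereal_scope.

(** * Hausdorff content as an outer measure *)

Section HausdorffContent.
Context {R : realType} {n : nat} (beta : R).
Implicit Types (E F : set 'rV[R]_n) (r : R).
Local Notation H := (@hcontent R n beta).

Lemma omega_ge0 : (0 <= omega beta)%R.
Proof.
rewrite /omega divr_ge0 ?powR_ge0// /Gamma.
by apply: Rintegral_ge0 => t _; rewrite mulr_ge0 ?powR_ge0 ?expR_ge0.
Qed.

Lemma omega_powR_ge0 r : 0 <= (omega beta * r `^ beta)%:E.
Proof. by rewrite lee_fin mulr_ge0 ?omega_ge0 ?powR_ge0. Qed.

Lemma hcontent_le_cover E (c : nat -> 'rV[R]_n) (r : nat -> R) :
  (forall j, 0 < r j)%R -> E `<=` \bigcup_j eucl_ball (c j) (r j) ->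
  H E <= \sum_(0 <= j <oo) (omega beta * r j `^ beta)%:E.
Proof. by move=> r0 Ecr; apply: ereal_inf_lbound => /=; exists c, r; split. Qed.

Lemma le_hcontent_cover E x :
  (forall (c : nat -> 'rV[R]_n) (r : nat -> R), (forall j, 0 < r j)%R ->
    E `<=` \bigcup_j eucl_ball (c j) (r j) ->
    x <= \sum_(0 <= j <oo) (omega beta * r j `^ beta)%:E) ->
  x <= H E.
Proof.
by move=> xle; apply: le_ereal_inf_tmp => _ [c [r [r0 Ecr ->]]]; exact: (xle c r).
Qed.

Lemma hcontent_ge0 E : 0 <= H E.
Proof.
apply: le_hcontent_cover => c r _ _; apply: nneseries_ge0 => j _ _.
exact: omega_powR_ge0.
Qed.

Lemma le_hcontent E F : E `<=` F -> H E <= H F.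
Proof.
move=> EF; apply: le_hcontent_cover => c r r0 Fcr.
by apply: hcontent_le_cover => //; exact: subset_trans Fcr.
Qed.

Lemma hcontent_sigma_subadditive (E : nat -> set 'rV[R]_n) :
  H (\bigcup_i E i) <= \sum_(0 <= i <oo) H (E i).
Proof.
have [[i Eioo]|] := pselect (exists i, H (E i) = +oo).
  rewrite (eseries_pinfty _ _ Eioo) ?leey// => j _.
  by rewrite -ltNye (lt_le_trans _ (hcontent_ge0 _)).
rewrite -forallNE => Eoo.
have Efin i : H (E i) \is a fin_num.
  by rewrite ge0_fin_numE ?hcontent_ge0// ltey; apply/eqP/Eoo.
apply/lee_addgt0Pr => e e0.
rewrite (le_trans _ (epsilon_trick _ _ (ltW e0)))//; last first.
  by move=> i; exact: hcontent_ge0.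
pose P i (cr : (nat -> 'rV[R]_n) * (nat -> R)) :=
  [/\ forall j, (0 < cr.2 j)%R, E i `<=` \bigcup_j eucl_ball (cr.1 j) (cr.2 j)
    & \sum_(0 <= j <oo) (omega beta * cr.2 j `^ beta)%:E
      <= H (E i) + (e / (2 ^ i.+1)%:R)%:E].
have [G PG] : {G & forall i, P i (G i)}.
  apply: (@choice _ _ P) => i.
  have ei : (0 < e / (2 ^ i.+1)%:R)%R by rewrite divr_gt0 ?ltr0n ?expn_gt0.
  have [_ [c [r [r0 Ecr ->]]] lte] := lb_ereal_inf_adherent ei (Efin i).
  by exists (c, r); split => //; exact/ltW.
have /card_esym/ppcard_eqP[f] := card_nat2.
have fbij : set_bij [set: nat] [set: nat * nat] f by exact: bij.
apply: (@le_trans _ _ (\sum_(0 <= k <oo)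
    (omega beta * (G (f k).1).2 (f k).2 `^ beta)%:E)).
  apply: (hcontent_le_cover (c := fun k => (G (f k).1).1 (f k).2)).
    by move=> k; case: (PG (f k).1).
  move=> x [i _ Eix]; have [_ /(_ _ Eix)[j _ xj] _] := PG i.
  have [_ _ /(_ (i, j) I)[k _ fk]] := fbij.
  by exists k => //; rewrite fk.
rewrite [leLHS]nneseries_esumT; last by move=> k; exact: omega_powR_ge0.
rewrite -(reindex_esum _ _ _ (fun p => (omega beta * (G p.1).2 p.2 `^ beta)%:E) fbij).
rewrite (_ : [set: nat * nat] = setT `*`` fun=> setT); last by apply/seteqP; split.
rewrite -(@esum_esum _ _ _ setT (fun=> setT)
  (fun i j => (omega beta * (G i).2 j `^ beta)%:E)); last first.
  by move=> *; exact: omega_powR_ge0.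
rewrite -nneseries_esumT; last first.
  by move=> i; apply: esum_ge0 => j _; exact: omega_powR_ge0.
apply: lee_nneseries => [i _ _|i _].
  by apply: esum_ge0 => j _; exact: omega_powR_ge0.
rewrite -nneseries_esumT; last by move=> j; exact: omega_powR_ge0.
by case: (PG i).
Qed.

Lemma hcontent_translate E v : H [set x | E (x + v)%R] <= H E.
Proof.
apply: le_hcontent_cover => c r r0 Ecr.
apply: (hcontent_le_cover (c := fun j => (c j - v)%R)) => // x /= /Ecr[j _ cjx].
exists j => //; move: cjx; rewrite /eucl_ball /=.
congr (is_true (Num.sqrt _ < _)%R); apply: eq_bigr => i _.
by rewrite !mxE; congr (_ ^+ 2)%R; ring.
Qed.

(** Half-open, so that dyadic cells are boxes and translates of one box tile a larger one. *)
Definition box (e : 'rV[R]_n) (h : R) : set 'rV[R]_n :=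
  [set x | forall i, (e ord0 i <= x ord0 i < e ord0 i + h)%R].

(** The crude factor [n.+1], in place of the square root of [n], keeps the bound strict and the
    radius positive for every [n]. *)
Lemma box_sub_eucl_ball e h : (0 < h)%R -> box e h `<=` eucl_ball e (n.+1%:R * h).
Proof.
move=> h0 x ex; rewrite /eucl_ball /=.
have nh0 : (0 < n.+1%:R * h)%R by rewrite mulr_gt0.
rewrite -[ltRHS]ger0_norm ?(ltW nh0)// -sqrtr_sqr ltr_sqrt ?exprn_gt0//.
apply: (@le_lt_trans _ _ (\sum_(i < n) h ^+ 2)%R).
  apply: ler_sum => i _; rewrite -[leLHS]sqrrN opprB.
  by move: (ex i) => /andP[? ?]; rewrite lerXn2r ?nnegrE; lra.
rewrite sumr_const card_ord -[X in (X < _)%R]mulr_natl exprMn ltr_pM2r ?exprn_gt0//.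
by rewrite -natrX ltr_nat; nia.
Qed.

Hypothesis beta_gt0 : (0 < beta)%R.

Lemma hcontent_eucl_ball c r : (0 < r)%R ->
  H (eucl_ball c r) <= (omega beta * r `^ beta)%:E.
Proof.
move=> r0; apply/lee_addgt0Pr => e e0.
have w0 : (0 < omega beta + 1)%R by rewrite ltr_wpDl ?omega_ge0.
(* Covers consist of infinitely many balls of positive radius, so the given ball is completed by
   balls of total size at most [e]. The divisor [omega beta + 1] is positive even if [omega beta]
   vanishes. *)
pose rad j := if j is 0 then r else
  ((e / (2 ^ j.+1)%:R / (omega beta + 1)) `^ beta^-1)%R.
have e2 j : (0 < e / (2 ^ j)%:R)%R by rewrite divr_gt0 ?ltr0n ?expn_gt0.
apply: (@le_trans _ _ (\sum_(0 <= j <oo) (omega beta * rad j `^ beta)%:E)).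
  apply: (hcontent_le_cover (c := fun=> c)); last by move=> x cx; exists 0%N.
  by case=> //= j; rewrite powR_gt0 ?divr_gt0.
pose A j := if j == 0%N then (omega beta * r `^ beta)%:E else 0.
have A0 j : 0 <= A j by rewrite /A; case: ifP => // _; exact: omega_powR_ge0.
have -> : (omega beta * r `^ beta)%:E = \sum_(0 <= j <oo) A j.
  rewrite -(eseries_mkcond (fun=> (omega beta * r `^ beta)%:E)).
  rewrite nneseries_esum; last by move=> *; exact: omega_powR_ge0.
  rewrite (_ : [set x | _] = [set 0%N]) ?esum_set1 ?omega_powR_ge0//.
  by apply/seteqP; split => j /= /eqP.
apply: le_trans (epsilon_trick _ A0 (ltW e0)).
apply: lee_nneseries => [j _ _|j _]; first exact: omega_powR_ge0.
case: j => [|j]; rewrite /A /rad /=; first by rewrite leeDl// lee_fin ltW.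
rewrite add0e lee_fin -powRrM mulVf ?gt_eqF// powRr1 ?(ltW (divr_gt0 (e2 _) w0))//.
rewrite [leLHS]mulrA ler_pdivrMr// mulrC ler_pM2l//; lra.
Qed.

Lemma hcontent0 : H set0 = 0.
Proof.
apply/eqP; rewrite eq_le hcontent_ge0 andbT; apply/lee_addgt0Pr => e e0.
have w0 : (0 < omega beta + 1)%R by rewrite ltr_wpDl ?omega_ge0.
apply: le_trans (le_hcontent (sub0set (eucl_ball 0%R
  ((e / (omega beta + 1)) `^ beta^-1)%R))) _.
apply: (le_trans (hcontent_eucl_ball _ _)); first by rewrite powR_gt0 ?divr_gt0.
rewrite add0e lee_fin -powRrM mulVf ?gt_eqF// powRr1 ?(ltW (divr_gt0 e0 w0))//.
rewrite [leLHS]mulrA ler_pdivrMr// mulrC ler_pM2l//; lra.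
Qed.

Lemma hcontent_box e h : (0 < h)%R ->
  H (box e h) <= (omega beta * (n.+1%:R * h) `^ beta)%:E.
Proof.
move=> h0; apply: (le_trans (le_hcontent (box_sub_eucl_ball h0))).
by apply: hcontent_eucl_ball; rewrite mulr_gt0.
Qed.

(** Reduces a countable union to finite duplicate-free lists, the form in which packing bounds are
    stated. *)
Lemma hcontent_bigcup_countType (T : countType) (D : set T)
    (A : T -> set 'rV[R]_n) (b : \bar R) :
  (forall s : seq T, uniq s -> (forall c, c \in s -> D c) ->
    \sum_(c <- s) H (A c) <= b) ->
  H (\bigcup_(c in D) A c) <= b.
Proof.
move=> sumAb.
pose A' j := if @pickle_inv T j is Some c then
  (if c \in D then A c else set0) else set0.
have AA' : \bigcup_(c in D) A c `<=` \bigcup_j A' j.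
  move=> x [c Dc Acx]; exists (pickle c) => //.
  by rewrite /A' pickleK_inv mem_set.
apply: (le_trans (le_hcontent AA')); apply: (le_trans (hcontent_sigma_subadditive _)).
apply: lime_le; first by apply: is_cvg_nneseries => j _ _; exact: hcontent_ge0.
apply: nearW => N /=.
pose s := [seq c <- pmap (@pickle_inv T) (index_iota 0 N) | c \in D].
have -> : \sum_(0 <= j < N) H (A' j) = \sum_(c <- s) H (A c).
  rewrite /s; elim: (index_iota 0 N) => [|j l IH]; first by rewrite !big_nil.
  rewrite big_cons IH /A' /=; case: pickle_inv => [c|] /=; last by rewrite hcontent0 add0e.
  by case: ifP; rewrite ?big_cons// hcontent0 add0e.
apply: sumAb => [|c]; last by rewrite mem_filter => /andP[+ _] => /set_mem.
by rewrite filter_uniq// (pmap_uniq (@pickle_invK T))// iota_uniq.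
Qed.

Lemma hcontent_bigcup_finType (I : finType) (A : I -> set 'rV[R]_n) :
  H (\bigcup_i A i) <= \sum_i H (A i).
Proof.
apply: hcontent_bigcup_countType => s us _.
rewrite big_uniq//= big_mkcond/=; apply: lee_sum => i _.
by case: ifP => // _; exact: hcontent_ge0.
Qed.

(** [E] is covered by [N.+1 ^ n] translates of [box p h], each of content at most [H P]. Such
    comparisons stand in for estimates of the content of a cube by a power of its side. *)
Lemma hcontent_tile E P e p h (N : nat) : (0 < h)%R ->
  box p h `<=` P -> E `<=` box e (N.+1%:R * h) ->
  H E <= (N.+1 ^ n)%:R%:E * H P.
Proof.
move=> h0 phP EeN.
pose ez (z : {ffun 'I_n -> 'I_N.+1}) : 'rV[R]_n :=
  \row_i (e ord0 i + (z i)%:R * h)%R.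
have Ez : E `<=` \bigcup_z box (ez z) h.
  move=> x /EeN ex; exists [ffun i => inord (Num.truncn ((x ord0 i - e ord0 i) / h))] => //.
  move=> i; rewrite /ez mxE ffunE.
  have /andP[x1 x2] := ex i.
  have q0 : (0 <= (x ord0 i - e ord0 i) / h)%R by rewrite divr_ge0 ?(ltW h0)// subr_ge0.
  have /andP[t1 t2] := truncn_itv q0.
  rewrite inordK; last first.
    rewrite -(ltr_nat R) (le_lt_trans t1)// ltr_pdivrMr//; lra.
  move: t1 t2; rewrite ler_pdivlMr// ltr_pdivrMr// -natr1 => t1 t2; lra.
have bP z : H (box (ez z) h) <= H P.
  apply: le_trans (le_hcontent phP).
  apply: le_trans (hcontent_translate (box p h) (p - ez z)%R).
  apply: le_hcontent => x zx i; move: (zx i) => /=; rewrite !mxE.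
  by move=> /andP[? ?]; lra.
apply: (le_trans (le_hcontent Ez)); apply: (le_trans (hcontent_bigcup_finType _)).
apply: (le_trans (lee_sum _ (fun z _ => bP z))).
by rewrite sumr_const card_ffun !card_ord mule_natl; exact: lexx.
Qed.

End HausdorffContent.

(** * Packed families in a tree of cells *)

Section Packing.
Context {R : realType} {X : Type} {T : choiceType}.
Variables (lab : nat -> X -> T) (H : set X -> \bar R).
Implicit Types (c d : nat * T) (s : seq (nat * T)) (S D : set (nat * T)).

Definition cell c : set X := [set x | lab c.1 x = c.2].

(** Generations are compared as well because one set may be a cell of several generations, while its
    dilate depends on the generation. *)
Definition subcell c d := (d.1 <= c.1)%N /\ cell c `<=` cell d.

Definition disjoint_cells S :=
  forall c d, S c -> S d -> cell c `&` cell d !=set0 -> c = d.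

(* Carleson-type condition, with the content of a cell in place of its mass. *)
Definition packed S := forall s, uniq s -> (forall c, c \in s -> S c) ->
  forall d, (forall c, c \in s -> subcell c d) ->
  \sum_(c <- s) H (cell c) <= 2%:E * H (cell d).

(** Once labels refine, cells that meet are nested by generation, so a member that meets no coarser
    member is maximal. *)
Definition maximal_cells D : set (nat * T) :=
  [set d | [/\ D d, cell d !=set0 &
    forall e, D e -> cell d `&` cell e !=set0 -> (d.1 <= e.1)%N]].

Hypothesis lab_refine : forall k x y, lab k.+1 x = lab k.+1 y -> lab k x = lab k y.

(** Equality of labels at a fine generation descends to all coarser ones, so a single common point
    forces nesting. *)
Lemma subcellP c d :
  cell c `&` cell d !=set0 -> (d.1 <= c.1)%N -> subcell c d.
Proof.
move=> [x [cx dx]] dc; split => // y cy.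
rewrite /cell/= -dx; rewrite /cell/= -cy in cx.
move: dc cx => /subnK <-; elim: (c.1 - d.1)%N => [->//|k IH].
by rewrite addSn => /lab_refine/IH.
Qed.

Lemma subcell_trans d c e : subcell c d -> subcell d e -> subcell c e.
Proof.
by move=> [dc scd] [ed sde]; split; [exact: leq_trans dc|exact: subset_trans sde].
Qed.

Lemma subcell_refl c : subcell c c. Proof. by split. Qed.

Lemma maximal_cells_disjoint D : disjoint_cells (maximal_cells D).
Proof.
move=> [k u] [l v] [Dc _ cmax] [Dd _ dmax] cd.
have := cmax _ Dd cd; have := dmax _ Dc; rewrite setIC => /(_ cd) /= lk kl.
have ekl : k = l by apply/eqP; rewrite eqn_leq lk kl.
by case: cd => x []; rewrite /cell /= ekl => <- <-.
Qed.

(** Among the members of [D] around [c], one has least generation; a strictly coarser member meeting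
    it would contain it, hence [c], against minimality. *)
Lemma exists_maximal_cell D c : D c -> cell c !=set0 ->
  exists2 d, maximal_cells D d & subcell c d.
Proof.
move=> Dc c0.
pose P k := `[< exists d, [/\ D d, subcell c d & d.1 = k] >].
have Pc : P c.1 by apply/asboolP; exists c; split => //; exact: subcell_refl.
case: (ex_minnP (ex_intro P _ Pc)) => k /asboolP[d [Dd scd <-]] kmin.
exists d => //; split => // [|e De de].
  by case: c0 => x cx; exists x; apply: scd.2.
rewrite leqNgt; apply/negP => ed.
have sde : subcell d e by apply: subcellP => //; exact: ltnW.
have /kmin : P e.1.
  by apply/asboolP; exists e; split => //; exact: subcell_trans sde.
by rewrite leqNgt ed.
Qed.

Hypothesis H_ge0 : forall E, 0 <= H E.
Hypothesis le_H : forall E F, E `<=` F -> H E <= H F.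
Hypothesis H0 : H set0 = 0.
Hypothesis H_cell_fin : forall c, H (cell c) \is a fin_num.

(** By Zorn's lemma: packing is tested on finite lists, and a finite list in the union of a chain
    lies in one member of the chain, unless it is empty. *)
Lemma exists_maximal_packed D : exists S, [/\ S `<=` D, packed S &
  forall d, D d -> ~ S d -> ~ packed (S `|` [set d])].
Proof.
pose P := [set S | S `<=` D /\ packed S].
have [|S [[SD pS] Smax]] := @Zorn_bigcup _ P.
  move=> F FP Ftot; split=> [c [S FS Sc]|]; first by have [+ _] := FP _ FS; apply.
  move=> s us sF d sd.
  suff [s0|[S FS sS]] : s = [::] \/ exists2 S, F S & forall c, c \in s -> S c.
    by rewrite s0 big_nil mule_ge0.
  - by have [_ pS] := FP _ FS; exact: pS.
  elim: s sF {us sd} => [|c s IH] sF; first by left.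
  right; have [S FS Sc] := sF _ (mem_head _ _).
  have [|s0|[S' FS' sS']] := IH.
  - by move=> e es; apply: sF; rewrite inE es orbT.
  - by exists S => // e; rewrite s0 inE => /eqP ->.
  - have [SS'|S'S] := Ftot _ _ FS FS'.
      exists S' => // e; rewrite inE => /orP[/eqP ->|]; [exact: SS'|exact: sS'].
    exists S => // e; rewrite inE => /orP[/eqP ->//|/sS'].
    exact: S'S.
exists S; split => // d Dd nSd pSd; apply: (Smax (S `|` [set d])).
  by split; [exact: subsetUl|move=> /(_ d); apply: contra_not nSd => /(_ (or_intror erefl))].
by split=> // c [/SD|->].
Qed.

(* [M] collects the maximal cells whose content is at most the total content of
   finitely many cells of [S] inside them. A maximal cell of [D] outside [S]
   violates the packing condition when added to [S], and the cell at which it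
   does so is such a cell. *)
Lemma exists_packing D : (forall c, D c -> cell c !=set0) ->
  exists S M, [/\ S `<=` D, disjoint_cells S, packed S,
    forall c, D c -> exists2 d, M d & subcell c d &
    forall s, uniq s -> (forall c, c \in s -> M c) ->
      exists s', [/\ uniq s', forall c, c \in s' -> S c &
        \sum_(c <- s) H (cell c) <= \sum_(c <- s') H (cell c)]].
Proof.
move=> D0.
have [S [SD pS Smax]] := exists_maximal_packed (maximal_cells D).
have Sdisj : disjoint_cells S.
  by move=> c d /SD Sc /SD Sd; exact: maximal_cells_disjoint Sc Sd.
pose full d s := [/\ uniq s, forall c, c \in s -> S c,
  forall c, c \in s -> subcell c d & H (cell d) <= \sum_(c <- s) H (cell c)].
pose M := [set d | exists s, full d s].
have DM c : maximal_cells D c -> exists2 d, M d & subcell c d.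
  move=> Dc; have [Sc|nSc] := pselect (S c).
    exists c; last exact: subcell_refl.
    exists [:: c]; split => //; last by rewrite big_seq1.
      by move=> e; rewrite inE => /eqP ->.
    by move=> e; rewrite inE => /eqP ->; exact: subcell_refl.
  have /existsNP[s /not_implyP[us /not_implyP[sSc]]] := Smax _ Dc nSc.
  move=> /existsNP[d /not_implyP[sd /negP]]; rewrite -ltNge => ltd.
  have cs : c \in s.
    apply/negPn/negP => ncs; move: ltd; apply/negP; rewrite -leNgt.
    apply: pS => // e es; have [//|ec] := sSc _ es.
    by move: es ncs; rewrite ec => ->.
  exists d; last exact: sd.
  exists (rem c s); split; first exact: rem_uniq.
  - move=> e; rewrite mem_rem_uniq// inE => /andP[/eqP ec es].
    by have [|/ec] := sSc _ es.
  - by move=> e /mem_rem; exact: sd.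
  (* The total exceeds [2 * H (cell d)] and [c] accounts for at most [H (cell d)] of it, so the
     remaining cells, all in [S], still total at least [H (cell d)]. This is the origin of the
     constant 2. *)
  move: ltd; rewrite (big_rem c cs)/=.
  have := le_H (sd _ cs).2.
  have : 0 <= \sum_(e <- rem c s) H (cell e) by apply: sume_ge0.
  move: (H_cell_fin c) (H_cell_fin d).
  case: (H (cell c)) => // a _; case: (H (cell d)) => // b _.
  case: (\sum_(e <- rem c s) H (cell e)) => [r| |] _ // ab; last by rewrite leey.
  move: ab; rewrite -EFinM !lee_fin => ab ltd.
  have {}ltd : (2 * b < a + r)%R by rewrite -lte_fin.
  lra.
exists S, (maximal_cells M); split => //.
- by move=> c /SD [].
- move=> c Dc; have [d Dd scd] := exists_maximal_cell Dc (D0 _ Dc).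
  have [e Me sde] := DM _ Dd.
  have [|f Mf sef] := exists_maximal_cell Me.
    by have [_ [x dx] _] := Dd; exists x; apply: sde.2.
  by exists f => //; exact: (subcell_trans scd (subcell_trans sde sef)).
(* The induction also records that each chosen cell lies in a cell of [s]: disjointness of the
   maximal cells then keeps the concatenated lists free of duplicates. *)
- suff key s : uniq s -> (forall c, c \in s -> maximal_cells M c) ->
      exists s', [/\ uniq s', forall c, c \in s' -> S c,
        forall c, c \in s' -> exists2 d, d \in s & subcell c d &
        \sum_(c <- s) H (cell c) <= \sum_(c <- s') H (cell c)].
    by move=> s us sM; have [s' [? ? _ ?]] := key s us sM; exists s'.
  elim: s => [|d s IH] /= us sM.
    by exists [::]; split => //; rewrite !big_nil.
  case/andP: us => ds us.
  have [|s' [us' s'S s's les']] := IH us.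
    by move=> c cs; apply: sM; rewrite inE cs orbT.
  have [[sd [usd sdS sdd lesd]] _ _] := sM _ (mem_head _ _).
  exists (sd ++ s'); split.
  + rewrite cat_uniq usd us' andbT /=; apply/hasPn => c /[dup] cs' /s's[e es sce].
    apply/negP => csd; have [x cx] : cell c !=set0.
      by have /SD [] := s'S _ cs'.
    suff de : d = e by move: ds; rewrite de es.
    apply: (@maximal_cells_disjoint M).
    * exact/sM/mem_head.
    * by apply: sM; rewrite inE es orbT.
    * by exists x; split; [exact: (sdd _ csd).2|exact: sce.2].
  + by move=> c; rewrite mem_cat => /orP[/sdS|/s'S].
  + move=> c; rewrite mem_cat => /orP[/sdd cd|/s's[e es sce]].
      by exists d => //; exact: mem_head.
    by exists e => //; rewrite inE es orbT.
  + by rewrite big_cons big_cat leeD.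
Qed.

(* By disjointness, either one cell of [s] contains [cell d], or all those that
   meet it are contained in it and the packing condition applies. *)
Lemma packed_cell S s d : disjoint_cells S -> packed S ->
  uniq s -> (forall c, c \in s -> S c) ->
  \sum_(c <- s) H (cell c `&` cell d) <= 2%:E * H (cell d).
Proof.
move=> dS pS us sS.
pose meet c := `[< cell c `&` cell d !=set0 >].
have -> : \sum_(c <- s) H (cell c `&` cell d) =
    \sum_(c <- s | meet c) H (cell c `&` cell d).
  rewrite [RHS]big_mkcond/=; apply: eq_bigr => c _.
  by rewrite /meet; case: asboolP => // /set0P/negP/negPn/eqP ->; rewrite H0.
have [/hasP[c cs /andP[/asboolP cd ltcd]]|/hasPn small] :=
  boolP (has (fun c => meet c && (c.1 < d.1)%N) s).
  have sdc : subcell d c by apply: subcellP; [rewrite setIC|exact: ltnW].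
  rewrite -big_filter (bigD1_seq c) ?filter_uniq ?mem_filter ?cs ?andbT//=; last exact/asboolP.
  rewrite big1_seq ?addr0.
    apply: (@le_trans _ _ (H (cell d))); first by apply: le_H; exact: subIsetr.
    by rewrite -[leLHS]mul1e lee_wpmul2r// lee_fin ler1n.
  move=> e /andP[ec]; rewrite mem_filter => /andP[/asboolP[x [ex dx]] es]; exfalso.
  move/eqP: ec; apply; apply: dS; [exact: sS|exact: sS|].
  by exists x; split => //; exact: sdc.2.
rewrite -big_filter.
apply: (@le_trans _ _ (\sum_(c <- [seq c <- s | meet c]) H (cell c))).
  by apply: lee_sum => c _; apply: le_H; exact: subIsetl.
apply: pS => [|c|c]; first exact: filter_uniq.
- by rewrite mem_filter => /andP[_ /sS].
- rewrite mem_filter => /andP[mc cs]; apply: subcellP; first exact/asboolP.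
  by have := small _ cs; rewrite mc /= -leqNgt.
Qed.

End Packing.

(** * Choquet integrals and dyadic cells *)

Section ChoquetIntegral.
Context {R : realType} {n : nat} (beta : R).
Hypothesis beta_gt0 : (0 < beta)%R.
Implicit Types (E F : set 'rV[R]_n) (g : 'rV[R]_n -> \bar R).
Local Notation H := (@hcontent R n beta).
Local Notation mu := (@lebesgue_measure R).

(** Preimages of upper rays are intervals, up to intersection with [D]. *)
Lemma nonincreasing_emeasurable (D : set R) (h : R -> \bar R) :
  measurable D -> (forall s t, (s <= t)%R -> h t <= h s) -> measurable_fun D h.
Proof.
move=> mD hle; apply: (measurability _ (ErealGenOInfty.measurableE R)).
move=> _ [_ [r ->] <-]; apply: measurableI => //.
apply: is_interval_measurable => s t; rewrite /= !in_itv/= !andbT => hs ht u.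
by move=> /andP[su ut]; rewrite in_itv/= andbT (lt_le_trans ht)// hle.
Qed.

Definition level_content E g (t : R) := H (E `&` [set x | t%:E < g x]).

Lemma measurable_level_content E g (D : set R) : measurable D ->
  measurable_fun D (level_content E g).
Proof.
move=> mD; apply: nonincreasing_emeasurable => // s t st.
apply: le_hcontent => x [Ex /= tx]; split => //=; apply: le_lt_trans tx.
by rewrite lee_fin.
Qed.

Lemma level_content_ge0 E g t : 0 <= level_content E g t.
Proof. exact: hcontent_ge0. Qed.

Hint Resolve measurable_level_content level_content_ge0 : core.

(** Outside [E] the restricted function is [0], which exceeds no level [t > 0]. *)
Lemma choquet_onE E g :
  choquet_on beta E g = \int[mu]_(t in `]0%R, +oo[) level_content E g t.
Proof.
apply: eq_integral => t; rewrite inE/= in_itv/= andbT => t0; congr H.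
apply/seteqP; split => x /=; rewrite patchE; case: ifPn.
- by move=> /set_mem.
- by rewrite lte_fin ltNge (ltW t0).
- by move=> _ [].
- by move=> xE [/mem_set]; rewrite (negbTE xE).
Qed.

Lemma choquet_on_ge0 E g : 0 <= choquet_on beta E g.
Proof. by rewrite choquet_onE; apply: integral_ge0. Qed.

Lemma le_choquet_on E F g : E `<=` F -> choquet_on beta E g <= choquet_on beta F g.
Proof.
move=> EF; rewrite !choquet_onE; apply: ge0_le_integral => //.
- exact: measurable_level_content.
- exact: measurable_level_content.
by move=> t _; apply: le_hcontent; exact: setSI.
Qed.

Lemma choquet_on_null E g : H E = 0 -> choquet_on beta E g = 0.
Proof.
move=> E0; rewrite choquet_onE integral0_eq// => t _; apply/eqP.
by rewrite eq_le hcontent_ge0 andbT -E0 le_hcontent.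
Qed.

Lemma choquet_on_bigcup (I : finType) (A : I -> set 'rV[R]_n) g :
  choquet_on beta (\bigcup_i A i) g <= \sum_i choquet_on beta (A i) g.
Proof.
rewrite choquet_onE; under eq_bigr do rewrite choquet_onE.
rewrite -ge0_integral_sum//; last by move=> i; exact: measurable_level_content.
apply: ge0_le_integral => //.
- exact: measurable_level_content.
- by apply: emeasurable_sum => i; exact: measurable_level_content.
move=> t _; rewrite /level_content setI_bigcupl.
exact: hcontent_bigcup_finType.
Qed.

(** The hypothesis is applied to each superlevel set of [g] inside [E], then integrated over the
    levels. *)
Lemma sum_choquet_on_le (I : Type) (s : seq I) (A : I -> set 'rV[R]_n) E g (C : R) :
  (0 <= C)%R ->
  (forall F, F `<=` E -> \sum_(i <- s) H (A i `&` F) <= C%:E * H F) ->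
  \sum_(i <- s) choquet_on beta (A i `&` E) g <= C%:E * choquet_on beta E g.
Proof.
move=> C0 sumC; rewrite choquet_onE; under eq_bigr do rewrite choquet_onE.
rewrite -ge0_integral_sum//; last by move=> i; exact: measurable_level_content.
rewrite -ge0_integralZl_EFin//; last exact: measurable_level_content.
apply: ge0_le_integral => //.
- by move=> t _; exact: sume_ge0.
- by apply: emeasurable_sum => i; exact: measurable_level_content.
- by apply: measurable_funeM; exact: measurable_level_content.
move=> t _; under eq_bigr do rewrite /level_content -setIA.
by apply: sumC; exact: subIsetl.
Qed.

End ChoquetIntegral.

Section DyadicCells.
Context {R : realType} {n : nat} (o : 'rV[R]_n) (L : R).
Hypothesis L_gt0 : (0 < L)%R.
Implicit Types E : set 'rV[R]_n.
Local Notation index := {ffun 'I_n -> int}.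

(** The grid has a free origin [o] and top side [L], fitted later to the cube under study. *)
Definition side (k : nat) : R := (L / 2 ^+ k)%R.

Lemma side_gt0 k : (0 < side k)%R.
Proof. by rewrite divr_gt0// exprn_gt0. Qed.

Definition dyadic_label (k : nat) (x : 'rV[R]_n) : index :=
  [ffun i => Num.floor ((x ord0 i - o ord0 i) / side k)].

Local Notation dcell := (cell dyadic_label).

Definition corner (c : nat * index) : 'rV[R]_n :=
  \row_i (o ord0 i + (c.2 i)%:~R * side c.1)%R.

Lemma dyadic_cellE c : dcell c = box (corner c) (side c.1).
Proof.
case: c => k u; apply/seteqP; split => x.
  rewrite /cell /= => <- i; rewrite /corner mxE ffunE /=.
  have := floor_itv ((x ord0 i - o ord0 i) / side k).
  rewrite ler_pdivlMr ?side_gt0// ltr_pdivrMr ?side_gt0// intrD mulr1z.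
  by move=> /andP[? ?]; lra.
move=> xu; apply/ffunP => i; have := xu i; rewrite /corner mxE ffunE /= => xui.
apply: floor_def; rewrite ler_pdivlMr ?side_gt0// ltr_pdivrMr ?side_gt0//.
by rewrite intrD mulr1z; lra.
Qed.

(** The integer part of [2 * u] determines that of [u]. *)
Lemma dyadic_label_refine k x y :
  dyadic_label k.+1 x = dyadic_label k.+1 y -> dyadic_label k x = dyadic_label k y.
Proof.
move=> xy; apply/ffunP => i; move/ffunP/(_ i): xy; rewrite !ffunE.
have sk z : (z / side k.+1 = 2 * (z / side k))%R.
  by rewrite /side exprS; field; rewrite expf_neq0//= gt_eqF.
rewrite !sk; set u := (_ / _)%R; set v := (_ / _)%R => uv.
apply/esym/floor_def.
have /andP[u1 u2] := floor_itv u; have /andP[v1 v2] := floor_itv (2 * v)%R.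
have /andP[w1 w2] := floor_itv (2 * u)%R; rewrite uv in w1 w2.
rewrite !intrD mulr1z in u2 v2 w2 *.
have a1 : (2 * Num.floor u <= Num.floor (2 * v))%R.
  by rewrite -uv floor_ge_int intrM; lra.
have a2 : (Num.floor (2 * v) < 2 * Num.floor u + 2)%R.
  by rewrite -(ltr_int R) intrD intrM; lra.
(* Integrality turns the strict inequality into a gap of one, which absorbs the fractional part of
   [2 * v]. *)
have a3 : (Num.floor (2 * v) + 1 <= 2 * Num.floor u + 2)%R by lia.
move: a1 a3; rewrite -!(ler_int R) !intrD !intrM => a1 a3; lra.
Qed.

(** Take the least [k] with [side k <= 2 * r]: either [k = 0] and the side is [L > r], or the
    previous side exceeds [2 * r]. *)
Lemma dyadic_scale r : (0 < r < L)%R -> exists k, (r < side k <= 2 * r)%R.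
Proof.
move=> /andP[r0 rL]; pose P k := (side k <= 2 * r)%R.
have [|k Pk kmin] := @ex_minnP P.
  exists (Num.truncn (L / r)).+1; rewrite /P /side ler_pdivrMr ?exprn_gt0//.
  have q0 : (0 <= L / r)%R by rewrite divr_ge0 ?ltW.
  have /andP[_] := truncn_itv q0; rewrite ltr_pdivrMr// => Lr.
  have : ((Num.truncn (L / r)).+1%:R <= 2 ^+ (Num.truncn (L / r)).+1 :> R)%R.
    by rewrite -natrX ler_nat ltnW// ltn_expl.
  by move: (_ ^+ _)%R (_ %:R)%R Lr => a b; nra.
exists k; rewrite andbC; apply/andP; split => //.
case: k Pk kmin => [|k] _ kmin; first by rewrite /side expr0 divr1.
have : ~~ P k by apply/negP => /kmin; rewrite ltnn.
rewrite -ltNge /side exprS invfM => ?; lra.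
Qed.

(** In each coordinate the label differs from that of [a] by at most one. Three values would do;
    four agree with the splitting of [box o (4 * L)] into cells of side [L]. *)
Lemma near_dyadic_cells k (a : 'rV[R]_n) E :
  (forall x, E x -> forall i, (`|x ord0 i - a ord0 i| < side k)%R) ->
  exists m : {ffun 'I_n -> 'I_4} -> index, E `<=` \bigcup_z dcell (k, m z).
Proof.
move=> Ea; pose m0 i := (Num.floor ((a ord0 i - o ord0 i) / side k) - 1)%R.
exists (fun z : {ffun 'I_n -> 'I_4} => [ffun i => m0 i + (z i)%:Z]%R) => x Ex.
pose f i := Num.floor ((x ord0 i - o ord0 i) / side k).
have fm i : (0 <= f i - m0 i < 4)%R.
  have := Ea _ Ex i; rewrite ltr_norml => /andP[xa1 xa2].
  have s0 := side_gt0 k.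
  have /andP[] := floor_itv ((x ord0 i - o ord0 i) / side k).
  have /andP[] := floor_itv ((a ord0 i - o ord0 i) / side k).
  rewrite !ler_pdivlMr// !ltr_pdivrMr// !intrD mulr1z -/(f i) => a1 a2 x1 x2.
  rewrite /m0; set A := Num.floor _ in a1 a2 *.
  have lo : ((A - 2)%:~R < (f i)%:~R :> R)%R.
    by rewrite -(ltr_pM2r s0) intrD; lra.
  have hi : ((f i)%:~R < (A + 2)%:~R :> R)%R.
    by rewrite -(ltr_pM2r s0) intrD; lra.
  by move: lo hi; rewrite !ltr_int; lia.
exists [ffun i => inord `|f i - m0 i|%N] => //; rewrite /cell /=.
apply/ffunP => i; rewrite !ffunE inordK; have := fm i; rewrite /f; lia.
Qed.

Variable beta : R.
Hypothesis beta_gt0 : (0 < beta)%R.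
Local Notation H := (@hcontent R n beta).

Lemma hcontent_dyadic_cell_fin c : H (dcell c) \is a fin_num.
Proof.
rewrite ge0_fin_numE ?hcontent_ge0// dyadic_cellE.
by apply: (le_lt_trans (hcontent_box beta_gt0 _ (side_gt0 _))); rewrite ltry.
Qed.

(* A ball of radius [r], intersected with [box o (4 * L)], lies in [4 ^ n]
   dyadic cells of side at most [2 * r]. *)
Definition packing_cst : R := (2 * (4 ^ n)%:R * (2 * n.+1%:R) `^ beta)%R.

(* Radii above [L] are harmless because [box o (4 * L)] is a union of [4 ^ n]
   cells of generation [0]. *)
Lemma packed_eucl_ball (S : set (nat * index)) s c (r : R) :
  disjoint_cells dyadic_label S -> packed dyadic_label H S ->
  uniq s -> (forall c, c \in s -> S c) -> (0 < r)%R ->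
  \sum_(e <- s) H (dcell e `&` (eucl_ball c r `&` box o (4 * L))) <=
    packing_cst%:E * (omega beta * r `^ beta)%:E.
Proof.
move=> dS pS us sS r0; set B := _ `&` _.
suff [k kr [m Bm]] : exists2 k, (side k <= 2 * r)%R &
    exists m : {ffun 'I_n -> 'I_4} -> index, B `<=` \bigcup_z dcell (k, m z).
  apply: (@le_trans _ _ (\sum_(e <- s) \sum_z H (dcell e `&` dcell (k, m z)))).
    apply: lee_sum => e _; apply: le_trans (hcontent_bigcup_finType beta_gt0 _).
    apply: le_hcontent; rewrite -setI_bigcupr; exact: setIS.
  rewrite exchange_big/=.
  (* The outer 2 is that of [packed_cell]; a cell of side at most [2 * r] fits in a ball of radius
     [n.+1 * (2 * r)]. *)
  pose b := (2 * (omega beta * (n.+1%:R * (2 * r)) `^ beta))%R.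
  apply: (@le_trans _ _ (\sum_(z : {ffun 'I_n -> 'I_4}) b%:E)).
    apply: lee_sum => z _.
    apply: (@le_trans _ _ (2%:E * H (dcell (k, m z)))).
      apply: (packed_cell dyadic_label_refine _ _ _ _ dS pS us sS).
      - exact: hcontent_ge0.
      - exact: le_hcontent.
      - exact: hcontent0.
    rewrite /b EFinM lee_pmul2l// dyadic_cellE.
    apply: (le_trans (hcontent_box beta_gt0 _ (side_gt0 _))).
    rewrite lee_fin ler_wpM2l ?omega_ge0// ge0_ler_powR ?(ltW beta_gt0)//.
    + by rewrite nnegrE mulr_ge0// (ltW (side_gt0 _)).
    + by rewrite nnegrE !mulr_ge0// ltW.
    + by rewrite ler_pM2l.
  rewrite sumEFin sumr_const card_ffun !card_ord -EFinM lee_fin -[leLHS]mulr_natl.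
  rewrite /b /packing_cst (_ : n.+1%:R * (2 * r) = 2 * n.+1%:R * r)%R; last by ring.
  rewrite (@powRM _ (2 * n.+1%:R) r) ?(ltW r0) ?mulr_ge0//.
  by rewrite le_eqVlt; apply/orP; left; apply/eqP; ring.
have [Lr|rL] := leP L r.
  exists 0%N; first by rewrite /side expr0 divr1; lra.
  have s0 : side 0 = L by rewrite /side expr0 divr1.
  exists (fun z : {ffun 'I_n -> 'I_4} => [ffun i => (z i)%:Z]%R) => x [_ xb].
  exists [ffun i => inord `|Num.floor ((x ord0 i - o ord0 i) / L)|%N] => //.
  rewrite /cell /=; apply/ffunP => i; rewrite !ffunE s0.
  have /andP[x1 x2] := xb i.
  have f0 : (0 <= Num.floor ((x ord0 i - o ord0 i) / L))%R.
    by rewrite floor_ge_int mulr0z divr_ge0 ?(ltW L_gt0)// subr_ge0.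
  have f4 : (Num.floor ((x ord0 i - o ord0 i) / L) < 4)%R.
    rewrite -(ltr_int R); apply: le_lt_trans (floor_le _) _.
    by rewrite ltr_pdivrMr//; lra.
  by rewrite inordK; move: f0 f4; lia.
have [|k /andP[rk kr]] := @dyadic_scale r; first by rewrite r0.
exists k => //; apply: (near_dyadic_cells (a := c)) => x [cx _] i.
apply: le_lt_trans rk; move: cx; rewrite /eucl_ball /=.
move=> /ltW; apply: le_trans; rewrite -sqrtr_sqr ler_wsqrtr//.
rewrite (bigD1 i)//= -[leLHS]addr0 lerD//; last by apply: sumr_ge0 => *; exact: sqr_ge0.
by rewrite -sqrrN opprB.
Qed.

End DyadicCells.

(** * The weak-type estimate *)

Section WeakType.
Context {R : realType} {n : nat} (beta : R) (o : 'rV[R]_n) (L : R).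
Hypotheses (beta_gt0 : (0 < beta)%R) (L_gt0 : (0 < L)%R).
Local Notation H := (@hcontent R n beta).
Local Notation index := {ffun 'I_n -> int}.
Local Notation dcell := (cell (dyadic_label o L)).
Local Notation C := (@packing_cst R n beta).

Lemma packing_cst_gt0 : (0 < C)%R.
Proof. by rewrite !mulr_gt0// ?ltr0n ?expn_gt0// powR_gt0// mulr_gt0. Qed.

(** The substitute for additivity. Each ball of a cover of [F] is treated by [packed_eucl_ball], and
    the infimum over covers is taken last. *)
Lemma packed_sum_le (S : set (nat * index)) s F :
  disjoint_cells (dyadic_label o L) S -> packed (dyadic_label o L) H S ->
  uniq s -> (forall c, c \in s -> S c) -> F `<=` box o (4 * L) ->
  \sum_(e <- s) H (dcell e `&` F) <= C%:E * H F.
Proof.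
move=> dS pS us sS FB; rewrite -lee_pdivrMl ?packing_cst_gt0//.
apply: le_hcontent_cover => c r r0 Fcr; rewrite lee_pdivrMl ?packing_cst_gt0//.
rewrite -nneseriesZl; last by move=> j _; exact: omega_powR_ge0.
apply: (@le_trans _ _ (\sum_(e <- s) \sum_(0 <= j <oo)
    H (dcell e `&` (eucl_ball (c j) (r j) `&` box o (4 * L))))).
  apply: lee_sum => e _; apply: le_trans (hcontent_sigma_subadditive _ _).
  apply: le_hcontent => x [ex Fx]; have [j _ xj] := Fcr _ Fx.
  by exists j => //; split => //; split => //; exact: FB.
rewrite -nneseries_sum; last by move=> *; exact: hcontent_ge0.
apply: lee_nneseries => [j _ _|j _]; first by apply: sume_ge0 => *; exact: hcontent_ge0.
exact: (packed_eucl_ball L_gt0 beta_gt0 _ dS pS us sS (r0 j)).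
Qed.

(** Wide enough to contain every cube that meets the cell and is shorter than its side. *)
Definition dilated_cell (c : nat * index) : set 'rV[R]_n :=
  [set y | exists2 z, dcell c z &
    forall i, (`|y ord0 i - z ord0 i| < side L c.1)%R].

Lemma hcontent_dilated_cell c : H (dilated_cell c) <= (3 ^ n)%:R%:E * H (dcell c).
Proof.
have s0 := side_gt0 L_gt0 c.1.
apply: (hcontent_tile beta_gt0 (h := side L c.1) (p := corner o L c)
  (e := (corner o L c - const_mx (side L c.1))%R)) => //.
  by rewrite dyadic_cellE.
move=> y [z]; rewrite dyadic_cellE// => cz yz i.
have := cz i; have := yz i; rewrite !mxE ltr_norml => /andP[? ?] /andP[? ?].
by apply/andP; split; lra.
Qed.

Lemma dilated_subcell c d :
  subcell (dyadic_label o L) c d -> dilated_cell c `<=` dilated_cell d.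
Proof.
move=> [dc cd] y [z cz yz]; exists z; first exact: cd.
move=> i; apply: (lt_le_trans (yz i)).
rewrite /side ler_pM2l// lef_pV2 ?posrE ?exprn_gt0//.
by rewrite ler_eXn2l// ltr1n.
Qed.

(** A Vitali-type argument: dilates of the selected cells lie in dilates of cells of [M], whose
    contents are dominated by those of cells of [S]; these satisfy the defining inequality, and
    their integrals add up by [packed_sum_le]. *)
Lemma weak_type g (k : R) : (0 < k)%R ->
  H (\bigcup_(c in [set c | k%:E * H (dcell c) <
       choquet_on beta (dcell c `&` box o (4 * L)) g]) dilated_cell c)
  <= ((3 ^ n)%:R * C / k)%:E * choquet_on beta (box o (4 * L)) g.
Proof.
move=> k0; set D := [set c | _]; set B := box _ _.
have D0 c : D c -> dcell c !=set0.
  move=> Dc; apply/set0P/negP => /eqP c0; move: Dc; rewrite /D /= c0 set0I.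
  by rewrite hcontent0// mule0 choquet_on_null ?hcontent0// ltxx.
have [S [M [SD dS pS DM MS]]] := @exists_packing R _ _ (dyadic_label o L) H
  (@dyadic_label_refine _ _ _ _ L_gt0) (@hcontent_ge0 _ _ _) (@le_hcontent _ _ _)
  (hcontent_dyadic_cell_fin _ L_gt0 beta_gt0) D D0.
have DM' : \bigcup_(c in D) dilated_cell c `<=` \bigcup_(d in M) dilated_cell d.
  move=> y [c /DM[d Md cd] cy]; exists d => //; exact: dilated_subcell cd y cy.
apply: (le_trans (le_hcontent _ DM')).
apply: hcontent_bigcup_countType => // s us sM.
have [s' [us' s'S les']] := MS s us sM.
apply: (@le_trans _ _ (\sum_(c <- s) (3 ^ n)%:R%:E * H (dcell c))).
  by apply: lee_sum => c _; exact: hcontent_dilated_cell.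
rewrite -ge0_sume_distrr; last by move=> *; exact: hcontent_ge0.
rewrite -mulrA EFinM -muleA; apply: lee_wpmul2l; first by rewrite lee_fin.
apply: (le_trans les').
have ks : k%:E * \sum_(c <- s') H (dcell c) <= C%:E * choquet_on beta B g.
  apply: (@le_trans _ _ (\sum_(c <- s') choquet_on beta (dcell c `&` B) g)).
    rewrite ge0_sume_distrr; last by move=> *; exact: hcontent_ge0.
    by rewrite !big_seq; apply: lee_sum => c /s'S/SD/ltW.
  apply: sum_choquet_on_le => //; first exact/ltW/packing_cst_gt0.
  by move=> F FB; exact: (packed_sum_le dS pS).
rewrite mulrC EFinM -muleA -[leLHS]mul1e.
rewrite -(mulVf (lt0r_neq0 k0)) // EFinM -muleA.
by rewrite lee_wpmul2l// lee_fin invr_ge0 ltW.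
Qed.

End WeakType.

(** * Cubes and superlevel sets of the maximal function *)

Section Cubes.
Context {R : realType} {n : nat} (beta : R).
Hypothesis beta_gt0 : (0 < beta)%R.
Implicit Types (P Q : set 'rV[R]_n) (f : 'rV[R]_n -> \bar R).
Local Notation H := (@hcontent R n beta).

Lemma is_cube_box (e : 'rV[R]_n) h : (0 < h)%R -> is_cube (box e h).
Proof.
by move=> h0; exists e, h, (fun=> true), (fun=> true); split.
Qed.

(** Whichever faces belong to [Q], it contains the concentric half-open box of half the side. *)
Lemma is_cube_bounds Q : is_cube Q -> exists (a : 'rV[R]_n) (l : R), [/\ (0 < l)%R,
  box (a + const_mx (l / 4))%R (l / 2) `<=` Q &
  forall x, Q x -> forall i, (a ord0 i <= x ord0 i <= a ord0 i + l)%R].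
Proof.
move=> [a [l [b [c [l0 ->]]]]]; exists a, l; split => // x.
  move=> bx i; have := bx i; rewrite !mxE => /andP[x1 x2].
  rewrite itv_boundlr; apply/andP; split; case: (b i); case: (c i) => /=;
    rewrite !bnd_simp; lra.
move=> Qx i; have := Qx i; rewrite itv_boundlr => /andP[].
by case: (b i); case: (c i); rewrite !bnd_simp => x1 x2; apply/andP; split; lra.
Qed.

Lemma hcontent_cube_fin Q : is_cube Q -> H Q \is a fin_num.
Proof.
move=> /is_cube_bounds[a [l [l0 _ Qa]]]; rewrite ge0_fin_numE ?hcontent_ge0//.
have l2 : (0 < 2 * l)%R by rewrite mulr_gt0.
apply: (@le_lt_trans _ _ (H (box a (2 * l)))); last first.
  by apply: (le_lt_trans (hcontent_box beta_gt0 _ l2)); rewrite ltry.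
apply: le_hcontent => x /Qa xa i; have /andP[? ?] := xa i.
by apply/andP; split; lra.
Qed.

(* At [h = 0] the inverse is [+oo], and the left-hand side is [+oo * 0 = 0]. *)
Lemma le_average (h I : \bar R) (m : R) : (0 <= m)%R -> 0 <= h ->
  h \is a fin_num -> (h = 0 -> I = 0) -> (h^-1 * I <= m%:E) = (I <= m%:E * h).
Proof.
move=> m0; case: h => // h; rewrite lee_fin le_eqVlt => /orP[/eqP<-|h0] _ hI.
  by rewrite hI// !mule0 lee_fin m0 lexx.
by rewrite inver gt_eqF// lee_pdivrMl// muleC.
Qed.

Lemma choquet_cube_le f Q x (m : R) : is_cube Q -> Q x -> (0 <= m)%R ->
  maximal beta f x <= m%:E -> choquet_on beta Q (fun y => `|f y|) <= m%:E * H Q.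
Proof.
move=> cQ Qx m0 Mm; rewrite -le_average ?hcontent_ge0 ?hcontent_cube_fin//.
  by apply: le_trans Mm; apply: ereal_sup_ubound; exists Q.
exact: choquet_on_null.
Qed.

Lemma maximal_gtP f y (s : R) : (0 <= s)%R -> s%:E < maximal beta f y ->
  exists P, [/\ is_cube P, P y & s%:E * H P < choquet_on beta P (fun y => `|f y|)].
Proof.
move=> s0 /ereal_sup_gt[_ [P [cP Py] <-]]; rewrite ltNge => sP.
exists P; split => //; rewrite ltNge; apply: contra sP.
by rewrite le_average ?hcontent_ge0 ?hcontent_cube_fin//; exact: choquet_on_null.
Qed.

(** The factors come, in order, from dilating cells, from packing, from passing from a cube to one
    dyadic cell, and from enlarging [Q] to [B]. *)
Definition level_cst : R := ((3 ^ n)%:R * @packing_cst R n beta * (16 ^ n)%:R * (8 ^ n)%:R)%R.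

(* A cube [P] meeting [Q] with average above [s] is shorter than [Q]: otherwise
   a dilate of [P] contains [x] and its average is at most [m]. So [P] lies in
   a fixed dilate of [Q], and one of the [4 ^ n] dyadic cells of comparable size
   that cover [P] carries a fixed fraction of its integral. *)
Lemma hcontent_maximal_gt f Q x (m s : R) : is_cube Q -> Q x -> (0 <= m)%R ->
  maximal beta f x <= m%:E -> (0 < s)%R -> ((8 ^ n)%:R * m <= s)%R ->
  H (Q `&` [set y | s%:E < maximal beta f y]) <= (level_cst * m / s)%:E * H Q.
Proof.
move=> cQ Qx m0 Mm s0 ms; set g := fun y => `|f y|.
have [a [l [l0 aQ Qa]]] := is_cube_bounds cQ.
(* [B] extends from [a - l] to [a + 3 * l] in each coordinate, so it contains every cube shorter
   than [l] that meets [Q]. Its side is 8 times that of the inner box of [Q]. *)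
pose o : 'rV[R]_n := (a - const_mx l)%R; pose B := box o (4 * l).
have B0 : (0 < 4 * l)%R by rewrite mulr_gt0.
have QB : Q `<=` B.
  by move=> y /Qa ya i; have /andP[? ?] := ya i; rewrite !mxE; apply/andP; split; lra.
have HB : H B <= (8 ^ n)%:R%:E * H Q.
  apply: (hcontent_tile beta_gt0 (h := (l / 2)%R) (e := o) _ aQ).
    by rewrite divr_gt0.
  by rewrite (_ : 8%:R * (l / 2) = 4 * l)%R//; field.
have gB : choquet_on beta B g <= ((8 ^ n)%:R * m)%:E * H Q.
  apply: (le_trans (choquet_cube_le (is_cube_box _ B0) (QB _ Qx) m0 Mm)).
  by rewrite [(_ * m)%R]mulrC EFinM -muleA lee_wpmul2l.
(* One factor [4 ^ n] is lost in choosing one of [4 ^ n] cells, another in bounding the content of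
   that cell by the content of [P]. *)
pose k := (s / (16 ^ n)%:R)%R.
have k0 : (0 < k)%R by rewrite divr_gt0// ltr0n expn_gt0.
apply: (@le_trans _ _ (H (\bigcup_(c in [set c | k%:E * H (cell (dyadic_label o l) c) <
   choquet_on beta (cell (dyadic_label o l) c `&` B) g]) dilated_cell o l c))); last first.
  apply: (le_trans (weak_type _ beta_gt0 l0 _ k0)).
  apply: (@le_trans _ _ (((3 ^ n)%:R * @packing_cst R n beta / k)%:E *
      (((8 ^ n)%:R * m)%:E * H Q))).
    apply: lee_wpmul2l => //; rewrite lee_fin divr_ge0 ?(ltW k0)//.
    by rewrite mulr_ge0// ltW// packing_cst_gt0.
  rewrite muleA -EFinM le_eqVlt; apply/orP; left; apply/eqP; congr (_%:E * _).
  rewrite /k /level_cst; field; rewrite (lt0r_neq0 s0).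
  by rewrite pnatr_eq0 expn_eq0.
apply: le_hcontent => y [Qy /= /(maximal_gtP (ltW s0))[P [cP Py sP]]].
have [p [h [h0 pP Pp]]] := is_cube_bounds cP.
have h20 : (0 < h / 2)%R by rewrite divr_gt0.
have [lh|hl] := leP l h.
  exfalso; move: sP; apply/negP; rewrite -leNgt.
  (* As [l <= h] and [P] meets [Q], the box at [q] contains [x]. Its content is at most [8 ^ n]
     times that of [P], so the integral over [P] is at most [8 ^ n * m <= s] times [H P]. *)
  pose q : 'rV[R]_n := (p - const_mx h)%R.
  have q0 : (0 < 4 * h)%R by rewrite mulr_gt0.
  have Pq : P `<=` box q (4 * h).
    by move=> z /Pp zp i; have /andP[? ?] := zp i; rewrite !mxE; apply/andP; split; lra.
  have qx : box q (4 * h) x.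
    move=> i; rewrite !mxE; have /andP[? ?] := Qa _ Qx i.
    have /andP[? ?] := Qa _ Qy i; have /andP[? ?] := Pp _ Py i.
    by apply/andP; split; lra.
  apply: (le_trans (le_choquet_on _ _ Pq)).
  apply: (le_trans (choquet_cube_le (is_cube_box _ q0) qx m0 Mm)).
  apply: (@le_trans _ _ (m%:E * ((8 ^ n)%:R%:E * H P))).
    apply: lee_wpmul2l => //; apply: (hcontent_tile beta_gt0 (e := q) h20 pP).
    by rewrite (_ : 8%:R * (h / 2) = 4 * h)%R//; field.
  by rewrite muleA -EFinM lee_wpmul2r ?hcontent_ge0// lee_fin mulrC.
have [|j /andP[hj jh]] := @dyadic_scale R l l0 h; first by rewrite h0.
have [|M PM] := @near_dyadic_cells R n o l l0 j p P.
  move=> z /Pp zp i; apply: le_lt_trans hj; have /andP[? ?] := zp i.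
  by rewrite ler_norml; apply/andP; split; lra.
pose cl z := cell (dyadic_label o l) (j, M z).
have PB : P `<=` B.
  move=> z Pz i; have /andP[? ?] := Qa _ Qy i; have /andP[? ?] := Pp _ Py i.
  have /andP[? ?] := Pp _ Pz i; rewrite !mxE; apply/andP; split; lra.
have [z sz] : exists z, (s / (4 ^ n)%:R)%:E * H P < choquet_on beta (P `&` cl z) g.
  apply: contrapT => /forallNP small; move: sP; apply/negP; rewrite -leNgt.
  apply: (@le_trans _ _ (choquet_on beta (\bigcup_z (P `&` cl z)) g)).
    by apply: le_choquet_on => z Pz; have [u _ zu] := PM _ Pz; exists u.
  apply: (le_trans (choquet_on_bigcup beta_gt0 _ _)).
  apply: (@le_trans _ _ (\sum_(z : {ffun 'I_n -> 'I_4}) (s / (4 ^ n)%:R)%:E * H P)).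
    by apply: lee_sum => z _; rewrite leNgt; apply/negP/small.
  rewrite sumr_const card_ffun !card_ord -[leLHS]mule_natl muleA -EFinM.
  by rewrite mulrCA divff ?mulr1// pnatr_eq0 expn_eq0.
have Hcl : H (cl z) <= (4 ^ n)%:R%:E * H P.
  rewrite /cl dyadic_cellE//; apply: (hcontent_tile beta_gt0 (e := corner o l (j, M z)) h20 pP).
  move=> w cw i; have /andP[-> /=] := cw i; lra.
exists (j, M z) => /=.
  apply: (@le_lt_trans _ _ ((s / (4 ^ n)%:R)%:E * H P)).
    apply: (@le_trans _ _ (k%:E * ((4 ^ n)%:R%:E * H P))).
      by apply: lee_wpmul2l => //; rewrite lee_fin ltW.
    rewrite muleA -EFinM lee_wpmul2r ?hcontent_ge0// lee_fin /k.
    rewrite (_ : 16 = 4 * 4)%N// expnMn natrM le_eqVlt; apply/orP; left; apply/eqP.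
    by field; rewrite pnatr_eq0 expn_eq0.
  by apply: lt_le_trans sz _; apply: le_choquet_on => w [Pw cw]; split => //; exact: PB.
have [w [Pw cw]] : P `&` cl z !=set0.
  apply/set0P/negP => /eqP P0; move: sz; apply/negP; rewrite -leNgt P0.
  rewrite choquet_on_null ?hcontent0// mule_ge0 ?hcontent_ge0// lee_fin.
  by rewrite divr_ge0// ltW.
exists w => // i; apply: le_lt_trans hj.
have /andP[? ?] := Pp _ Py i; have /andP[? ?] := Pp _ Pw i.
by rewrite ler_norml; apply/andP; split; lra.
Qed.

End Cubes.

(** * Powers of the maximal function *)

Lemma powRK {R : realType} (d x : R) : (0 < d)%R -> (0 <= x)%R ->
  ((x `^ d) `^ d^-1 = x)%R.
Proof. by move=> d0 x0; rewrite -powRrM mulfV ?gt_eqF// powRr1. Qed.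

Lemma powRVK {R : realType} (d x : R) : (0 < d)%R -> (0 <= x)%R ->
  ((x `^ d^-1) `^ d = x)%R.
Proof. by move=> d0 x0; rewrite -powRrM mulVf ?gt_eqF// powRr1. Qed.

Lemma powRN_cvg0 {R : realType} (q : R) : (0 < q)%R ->
  (x `^ (- q) @[x --> +oo] --> 0)%R.
Proof.
move=> q0; apply/cvgrPdist_le => e e0; near=> x.
have x0 : (0 < x)%R by near: x; apply: nbhs_pinfty_gt; rewrite num_real.
rewrite sub0r normrN ger0_norm ?powR_ge0// powRN.
rewrite -[leRHS]invrK lef_pV2 ?posrE ?powR_gt0 ?invr_gt0//.
rewrite -[leLHS](powRVK q0) ?invr_ge0 ?(ltW e0)//.
rewrite ge0_ler_powR ?(ltW q0) ?nnegrE ?powR_ge0 ?(ltW x0)//.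
Unshelve. all: by end_near. Qed.

Lemma integral_powRN {R : realType} (T p : R) : (0 < T)%R -> (1 < p)%R ->
  \int[lebesgue_measure]_(t in `]T, +oo[) (t `^ (- p))%:E =
  (T `^ (1 - p) / (p - 1))%:E.
Proof.
move=> T0 p1; have gtT (x : R) : (T <= x)%R -> (0 < x)%R by exact: lt_le_trans.
have Fd (x : R) : (0 < x)%R ->
    is_derive x 1%R (fun t : R => - (p - 1)^-1 * t `^ (1 - p))%R (x `^ (- p))%R.
  move=> x0; have := is_derive1_powR (1 - p) x0 => d.
  apply: is_derive_eq; rewrite /GRing.scale/= (_ : 1 - p - 1 = - p)%R; last by ring.
  by field; rewrite subr_eq0 gt_eqF.
have cont (x : R) : (0 < x)%R ->
    {for x, continuous (fun t : R => - (p - 1)^-1 * t `^ (1 - p))%R}.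
  move=> x0; have [dF _] := Fd _ x0.
  by move/derivable1_diffP: dF; exact: differentiable_continuous.
rewrite integral_itv_obnd_cbnd; last first.
  apply/measurable_EFinP/measurable_funTS; exact: measurable_powR.
rewrite (@ge0_continuous_FTC2y _ _ (fun t : R => - (p - 1)^-1 * t `^ (1 - p))%R _ 0%R).
- by rewrite -EFinB; congr _%:E; ring.
- by move=> x _; exact: powR_ge0.
- apply: derivable_within_continuous => x; rewrite in_itv/= andbT => /gtT x0.
  by apply: derivable_powR; rewrite in_itv/= x0.
- rewrite -[X in _ --> X](mulr0 (- (p - 1)^-1)%R); apply: cvgMr.
  rewrite (_ : 1 - p = - (p - 1))%R; last by ring.
  by apply: powRN_cvg0; rewrite subr_gt0.
- by move=> x /ltW/gtT x0; have [] := Fd _ x0.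
- apply: cvg_at_right_filter; exact: (cont _ T0).
- move=> x; rewrite in_itv/= andbT => /ltW/gtT x0.
  by rewrite derive1E; have [_ ->] := Fd _ x0.
Qed.

Section MaximalPower.
Context {R : realType} {n : nat} (beta : R).
Hypothesis beta_gt0 : (0 < beta)%R.
Implicit Types (Q : set 'rV[R]_n) (f g : 'rV[R]_n -> \bar R).
Local Notation H := (@hcontent R n beta).
Local Notation mu := (@lebesgue_measure R).

Lemma maximal_ge0 f x : 0 <= maximal beta f x.
Proof.
have cx : is_cube (box x 1) by exact: is_cube_box.
apply: (@le_trans _ _
    ((H (box x 1))^-1 * choquet_on beta (box x 1) (fun y => `|f y|))).
  by rewrite mule_ge0 ?inve_ge0 ?hcontent_ge0 ?choquet_on_ge0.
apply: ereal_sup_ubound; exists (box x 1) => //; split => // i.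
by rewrite lexx ltrDl ltr01.
Qed.

Lemma choquet_on_split Q g (T : R) : (0 <= T)%R ->
  choquet_on beta Q g <= T%:E * H Q
    + \int[mu]_(t in `]T, +oo[) level_content beta Q g t.
Proof.
move=> T0; rewrite choquet_onE.
rewrite (@itv_bndbnd_setU _ _ _ (BRight T)) ?bnd_simp//.
rewrite ge0_integral_setU//=.
- apply: leeD => //; apply: (@le_trans _ _ (\int[mu]_(t in `]0%R, T]) cst (H Q) t)).
    apply: ge0_le_integral => //.
    + by move=> *; exact: level_content_ge0.
    + exact: measurable_level_content.
    + by move=> t _; apply: le_hcontent; exact: subIsetl.
  rewrite integral_cst//= (@lebesgue_measure_itv R) /= lte_fin muleC.
  by case: ifP => _; rewrite ?sube0// mul0e mule_ge0 ?hcontent_ge0.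
- by apply: measurable_level_content; exact: measurableU.
- by move=> *; exact: level_content_ge0.
- apply/disj_setPS => t [] /=; rewrite !in_itv/= andbT => /andP[_ tT] Tt.
  by move: (lt_le_trans Tt tT); rewrite ltxx.
Qed.

Lemma lt_poweR (y : \bar R) (t d : R) : (0 < t)%R -> (0 < d)%R -> 0 <= y ->
  t%:E < y `^ d -> (t `^ d^-1)%:E < y.
Proof.
case: y => [y| |] t0 d0 //; last by rewrite ltry.
rewrite poweR_EFin !lte_fin lee_fin => y0 ty.
rewrite ltNge; apply/negP => yt; move: ty; apply/negP; rewrite -leNgt.
rewrite -[leRHS](powRVK d0) ?(ltW t0)//.
by rewrite ge0_ler_powR ?(ltW d0) ?nnegrE ?powR_ge0.
Qed.

(** Level [t] of the power is level [s] of the maximal function, and the lower bound on [t] says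
    exactly that [s] reaches the threshold of [hcontent_maximal_gt]. *)
Lemma level_content_poweR f Q x (m d t : R) : is_cube Q -> Q x -> (0 <= m)%R ->
  maximal beta f x <= m%:E -> (0 < d)%R -> (0 < t)%R ->
  (((8 ^ n)%:R * m) `^ d <= t)%R ->
  level_content beta Q (fun y => `|maximal beta f y `^ d|) t
    <= (@level_cst R n beta * m)%:E * H Q * (t `^ (- d^-1))%:E.
Proof.
move=> cQ Qx m0 Mm d0 t0 mt; set s := (t `^ d^-1)%R.
have s0 : (0 < s)%R by rewrite powR_gt0.
have ms : ((8 ^ n)%:R * m <= s)%R.
  rewrite -[leLHS](powRK d0) ?mulr_ge0//.
  by rewrite ge0_ler_powR ?nnegrE ?powR_ge0 ?invr_ge0 ?(ltW d0) ?(ltW t0)//.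
rewrite muleAC -EFinM powRN -/s.
apply: le_trans (hcontent_maximal_gt beta_gt0 cQ Qx m0 Mm s0 ms).
apply: le_hcontent => y [Qy /= ty]; split => //.
apply: lt_poweR => //; first exact: maximal_ge0.
by rewrite gee0_abs ?poweR_ge0 in ty.
Qed.

(* Levels up to [T = (8 ^ n * m) `^ d] contribute at most [T * H Q]; above [T],
   the level sets decay like [t `^ (- d^-1)], which is integrable at infinity. *)
Lemma choquet_on_maximal_poweR f Q x (m d : R) : is_cube Q -> Q x -> (0 <= m)%R ->
  maximal beta f x <= m%:E -> (0 < d < 1)%R ->
  choquet_on beta Q (fun y => `|maximal beta f y `^ d|) <=
  (((8 ^ n)%:R `^ d +
    @level_cst R n beta * (8 ^ n)%:R `^ (d - 1) / (d^-1 - 1)) * m `^ d)%:E * H Q.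
Proof.
move=> cQ Qx m0 Mm /andP[d0 d1]; set A : R := (8 ^ n)%:R; set B := level_cst _.
have A0 : (0 < A)%R by rewrite ltr0n expn_gt0.
set T := ((A * m) `^ d)%R; have T0 : (0 <= T)%R by rewrite powR_ge0.
have HQ := hcontent_cube_fin beta_gt0 cQ.
have B0 : (0 <= B)%R by rewrite !mulr_ge0// ltW// packing_cst_gt0.
apply: (le_trans (choquet_on_split _ _ T0)).
apply: (@le_trans _ _ (T%:E * H Q +
    \int[mu]_(t in `]T, +oo[) ((B * m)%:E * H Q * (t `^ (- d^-1))%:E))).
  apply: leeD => //; apply: ge0_le_integral => //.
  - by move=> *; exact: level_content_ge0.
  - exact: measurable_level_content.
  - apply: measurable_funeM; apply/measurable_EFinP/measurable_funTS.
    exact: measurable_powR.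
  move=> t; rewrite /= in_itv/= andbT => Tt.
  apply: (level_content_poweR cQ Qx m0 Mm d0); last exact: ltW.
  exact: le_lt_trans Tt.
have d1' : (1 < d^-1)%R by rewrite invf_gt1.
rewrite -(fineK HQ) -EFinM ge0_integralZl_EFin//; first last.
- by rewrite mulr_ge0 ?mulr_ge0// fine_ge0 ?hcontent_ge0.
- by apply/measurable_EFinP/measurable_funTS; exact: measurable_powR.
- by move=> t _; rewrite lee_fin powR_ge0.
(* For [m = 0] the threshold [T] is 0 and the power is not integrable near it, but the coefficient
   [B * m] removes the tail. *)
move: m0; rewrite le_eqVlt => /orP[/eqP m0|m0].
  rewrite -m0 mulr0 !mul0r mul0e adde0 /T -m0 mulr0 -EFinM lee_fin.
  by rewrite powR0 ?gt_eqF// mul0r mulr0 mul0r.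
have {}T0 : (0 < T)%R by apply: powR_gt0; rewrite mulr_gt0.
rewrite integral_powRN// -!EFinM -EFinD lee_fin le_eqVlt; apply/orP; left; apply/eqP.
(* The power [d - 1] of [m] found here, multiplied by the [m] of the tail coefficient, gives the
   same power [d] as in [T]. *)
have -> : (T `^ (1 - d^-1) = A `^ (d - 1) * m `^ (d - 1))%R.
  rewrite /T -powRrM (_ : d * (1 - d^-1) = d - 1)%R; last first.
    by rewrite mulrBr mulr1 divff ?gt_eqF.
  by rewrite powRM// ltW.
rewrite /T powRM ?(ltW A0) ?(ltW m0)//.
have -> : (m `^ d = m * m `^ (d - 1))%R.
  rewrite -{2}[m]powRr1 ?(ltW m0)// -powRD; first by congr (_ `^ _)%R; ring.
  by rewrite (gt_eqF m0) implybT.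
ring.
Qed.

End MaximalPower.

Theorem theorem3p2 (R : realType) (n : nat) (beta : R)
    (beta_gt0 : (0 < beta)%R) (beta_le_n : (beta <= n%:R)%R)
    (f : 'rV[R]_n -> \bar R) (f_L1loc : L1loc beta f)
    (Mf_fin : quasi_every beta (fun x => (maximal beta f x < +oo)%E))
    (delta : R) (delta_ge0 : (0 <= delta)%R) (delta_lt1 : (delta < 1)%R) :
  A1_weight beta (fun x => (maximal beta f x `^ delta)%E).
Proof.
split=> [x|]; first exact: poweR_ge0.
suff [K K0 MK] : exists2 K : R, (0 < K)%R & forall Q x, is_cube Q -> Q x ->
    (hcontent beta Q)^-1 *
      choquet_on beta Q (fun y => `|maximal beta f y `^ delta|) <=
    K%:E * (maximal beta f x `^ delta).
  exists K; split => //; exists set0; split => [|x _]; first exact: hcontent0.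
  by apply: ge_ereal_sup => _ [Q [cQ Qx] <-]; exact: MK.
move: delta_ge0; rewrite le_eqVlt => /orP[/eqP<-|d0].
  (* Exponent 0 sends every value, [+oo] included, to 1, so only levels below 1 contribute. *)
  exists 1%R => // Q x cQ Qx; rewrite poweRe0 mul1e.
  rewrite le_average ?hcontent_ge0 ?hcontent_cube_fin//; last exact: choquet_on_null.
  apply: (le_trans (choquet_on_split _ _ _ ler01)); rewrite -[leRHS]adde0.
  rewrite leeD// integral0_eq// => t; rewrite /= in_itv/= andbT => t1.
  rewrite /level_content (_ : _ `&` _ = set0) ?hcontent0//.
  apply/seteqP; split => // y [_] /=.
  by rewrite poweRe0 gee0_abs// lte_fin ltNge (ltW t1).
pose K : R := ((8 ^ n)%:R `^ delta + @level_cst R n beta *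
  (8 ^ n)%:R `^ (delta - 1) / (delta^-1 - 1))%R.
have K0 : (0 < K)%R.
  rewrite ltr_wpDr ?powR_gt0 ?ltr0n ?expn_gt0// divr_ge0//.
    by rewrite !mulr_ge0 ?powR_ge0// ltW// packing_cst_gt0.
  by rewrite subr_ge0 ltW// invf_gt1.
exists K => // Q x cQ Qx.
have := maximal_ge0 beta f x; case Mx : (maximal beta f x) => [m| |] // m0.
  rewrite poweR_EFin -EFinM le_average ?hcontent_ge0 ?hcontent_cube_fin//.
  - by apply: (choquet_on_maximal_poweR beta_gt0 cQ Qx) => //; rewrite ?Mx ?d0.
  - by rewrite mulr_ge0 ?powR_ge0// ltW.
  - exact: choquet_on_null.
(* Where the maximal function is infinite the right-hand side is [+oo], as [delta] and [K] are
   positive. *)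
by rewrite poweRyr ?gt_eqF// gt0_muley ?lte_fin// leey.
Qed.
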